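(* Let $r:\mathbb{R}^{n\times p}\to\mathbb{R}$ be convex (possibly non-smooth), let $\beta>0$, $X_{k+1}\in\mathcal{S}_{n,p}$ and $\Lambda_k\in\mathbb{R}^{n\times p}$. The problem $$\min_{Y\in\mathbb{R}^{n\times p}}\; r(Y)+\langle\Lambda_k,X_{k+1}-Y\rangle+\frac{\beta}{2}\|X_{k+1}-Y\|_F^2$$ has the closed-form solution $$Y_{k+1}=\mathrm{Prox}_{\frac{r(\cdot)}{\beta}}\Big(X_{k+1}+\frac{\Lambda_k}{\beta}\Big),$$ and, with $\Lambda_{k+1}:=\Lambda_k+\beta(X_{k+1}-Y_{k+1})$, one has $\Lambda_{k+1}\in\partial r(Y_{k+1})$. Moreover, if $r(Y)=\mu\|Y\|_1=\mu\sum_{i,j}|Y_{ij}|$ with $\mu>0$, then the proximal operator is given by soft-thresholding: for every $Z\in\mathbb{R}^{n\times p}$ and all $i,j$, $$\Big(\mathrm{Prox}_{\frac{r(\cdot)}{\beta}}(Z)\Big)_{ij}=\mathrm{sign}(Z_{ij})\max\{|Z_{ij}|-\mu/\beta,\,0\}.$$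
   Context: $\mathcal{S}_{n,p}=\{X\in\mathbb{R}^{n\times p}:X^{T}X=I_p\}$ is the Stiefel manifold, $\langle X,Y\rangle=\mathrm{tr}(X^{T}Y)$, and $\|\cdot\|_F$ is the Frobenius norm. For a convex function $h:\mathbb{R}^{n\times p}\to\mathbb{R}$, $\partial h$ denotes its convex subdifferential and $\mathrm{Prox}_{h}(Z)=\arg\min_{Y\in\mathbb{R}^{n\times p}}\{h(Y)+\frac12\|Y-Z\|_F^2\}$. *)

(* Defs.v *)
From HB Require Import structures.
From mathcomp Require Import all_boot all_order all_algebra.
From mathcomp Require Import all_classical all_reals all_analysis.

Set Implicit Arguments.
Unset Strict Implicit.
Unset Printing Implicit Defensive.

Import Order.TTheory GRing.Theory Num.Theory.

Local Open Scope classical_set_scope.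
Local Open Scope ring_scope.

Section MatrixOptimization.
Context {R : realType} {n p : nat}.
Implicit Types (X Y Z W G : 'M[R]_(n, p)) (f h : 'M[R]_(n, p) -> R).

Definition stiefel : set 'M[R]_(n, p) := [set X | X^T *m X = 1%:M].

Definition mxinner X Y : R := \tr (X^T *m Y).

Definition frobenius_norm X : R := Num.sqrt (mxinner X X).

Definition mxnorm1 X : R := \sum_(i < n) \sum_(j < p) `|X i j|.

Definition subdifferential h Y : set 'M[R]_(n, p) :=
  [set G | forall W, h Y + mxinner G (W - Y) <= h W].

Definition argmin f : set 'M[R]_(n, p) := [set Y | forall W, f Y <= f W].

Definition prox_objective h Z Y : R :=
  h Y + 2^-1 * frobenius_norm (Y - Z) ^+ 2.

(* [xget] returns the default 0 when the argmin set is empty and picks a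
   minimizer when there are several, so this is the usual single-valued
   operator only where [argmin (prox_objective h Z)] is a singleton. *)
Definition prox h Z : 'M[R]_(n, p) := xget 0 (argmin (prox_objective h Z)).

End MatrixOptimization.

Arguments stiefel {R} n p.

(* Main.v *)
Require Import Defs.
From HB Require Import structures.
From mathcomp Require Import all_boot all_order all_algebra.
From mathcomp Require Import all_classical all_reals all_analysis.
From mathcomp Require Import ring lra.

(** The theorem reduces to two facts about a finite convex [h] on matrices and
    its proximal objective [F Y = h Y + |Y - Z|^2 / 2]: [F] has exactly one
    minimizer, and that minimizer [Y] is characterized by the inclusion
    [Z - Y] in the subdifferential of [h] at [Y].

    Existence is the only analytic point.  Since [h] is finite everywhere, at
    every point [Y] its graph lies above a downward cone,
    [h W >= h Y - C |W - Y|_1]: the base point is a convex combination of [W]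
    and of the points [Y +/- E_ij], so Jensen's inequality bounds [h W] from
    below by the values of [h] at these finitely many points
    ([convex_cone_minorant]).  This cone inequality serves twice.  For [h] at
    [Z] it shows that the quadratic term wins, so [F] is bounded below.  For [F]
    at a limit point it is lower semicontinuity.  The limit point comes from
    strong convexity: the midpoint inequality bounds the distance of any [Y] and
    [W] by [rad Y + rad W] with [rad Y = 2 sqrt (F Y - inf F)], so entrywise
    the intervals of radius [rad Y] around [Y i j] intersect pairwise, hence
    have a common point in R.  The matrix [L] of these points satisfies
    [F L <= F Y + K * rad Y] for every [Y], and letting [F Y] tend to [inf F]
    shows that [L] is a minimizer ([strongly_convex_argmin]).

    A minimizer of a strongly convex function is in fact a minimizer with
    quadratic growth ([argmin_quadratic_growth]).  For the proximal objective,
    expanding the squares turns this growth inequality literally into the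
    subgradient inequality for [Z - Y], which gives
    [argmin_prox_subdifferential]; growth also gives uniqueness.

    The three assertions follow.  Completing the square shows that the objective
    of the subproblem is [beta] times the proximal objective of [r / beta] at
    [X + Lambda / beta], up to a constant.  The multiplier [Lambda1] is [beta]
    times the residual [Z - Y1], hence a subgradient of [r].  Soft-thresholding
    is checked against the subgradient characterization, which for the l1 norm
    splits into one scalar inequality per entry. *)

Set Implicit Arguments.
Unset Strict Implicit.
Unset Printing Implicit Defensive.

Import Order.TTheory GRing.Theory Num.Theory.

Local Open Scope classical_set_scope.
Local Open Scope ring_scope.

Section Convexity.
Context {R : realType} {n p : nat}.
Implicit Types (X Y Z W V G : 'M[R]_(n, p)) (f h F : 'M[R]_(n, p) -> R).
Implicit Types (a b c e t : R).

(** * The inner product in coordinates *)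

Lemma mxinnerE X Y :
  mxinner X Y = \sum_(k : 'I_n * 'I_p) X k.1 k.2 * Y k.1 k.2.
Proof.
rewrite /mxinner /mxtrace.
under eq_bigr => j _.
  rewrite mxE; under eq_bigr => i _ do rewrite mxE; over.
by rewrite exchange_big /= pair_bigA.
Qed.

Lemma mxnorm1E X : mxnorm1 X = \sum_(k : 'I_n * 'I_p) `|X k.1 k.2|.
Proof. by rewrite /mxnorm1 pair_bigA. Qed.

Lemma mxinner_ge0 X : 0 <= mxinner X X.
Proof. by rewrite mxinnerE sumr_ge0// => k _; rewrite -expr2 sqr_ge0. Qed.

Lemma sqr_frobenius_norm X : frobenius_norm X ^+ 2 = mxinner X X.
Proof. by rewrite sqr_sqrtr// mxinner_ge0. Qed.

Lemma mxinner_eq0 X : (mxinner X X == 0) = (X == 0).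
Proof.
apply/eqP/eqP => [|->]; last first.
  by rewrite mxinnerE big1// => k _; rewrite !mxE mul0r.
rewrite mxinnerE => /psumr_eq0P X0; apply/matrixP => i j; rewrite mxE.
have /= := X0 _ (i, j) isT; rewrite -expr2 => H.
by apply/eqP; rewrite -sqrf_eq0; apply/eqP/H => k _; rewrite -expr2 sqr_ge0.
Qed.

Lemma sqr_entry_le X i j : X i j ^+ 2 <= mxinner X X.
Proof.
rewrite mxinnerE (bigD1 (i, j))//= expr2 lerDl sumr_ge0// => k _.
by rewrite -expr2 sqr_ge0.
Qed.

(** The defect of convexity of the square is an exact quadratic term: this is
    where the strong convexity of the proximal objective comes from. *)
Lemma mxinner_convex t Y W Z :
  mxinner (t *: Y + (1 - t) *: W - Z) (t *: Y + (1 - t) *: W - Z) =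
  t * mxinner (Y - Z) (Y - Z) + (1 - t) * mxinner (W - Z) (W - Z)
    - t * (1 - t) * mxinner (Y - W) (Y - W).
Proof.
rewrite !mxinnerE !mulr_sumr -big_split -sumrB /=.
by apply: eq_bigr => k _; rewrite !mxE; ring.
Qed.

(** The law of cosines; it converts quadratic growth around [Y] into an affine
    minorant, and back. *)
Lemma mxinner_cosine Y W Z :
  mxinner (W - Z) (W - Z) =
  mxinner (W - Y) (W - Y) + mxinner (Y - Z) (Y - Z)
    - 2 * mxinner (Z - Y) (W - Y).
Proof.
rewrite !mxinnerE !mulr_sumr -big_split -sumrB /=.
by apply: eq_bigr => k _; rewrite !mxE; ring.
Qed.

(** * Convex functions lie above downward cones *)

Lemma convex_functionP h :
  convex_function [set: 'M[R]_(n, p)] h <->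
  forall t Y W, 0 <= t <= 1 ->
    h (t *: Y + (1 - t) *: W) <= t * h Y + (1 - t) * h W.
Proof.
split=> [hc t Y W t01|hc t Y W _ _]; last first.
  by apply: hc; rewrite ge0 le1.
by apply: (hc (Itv01 (andP t01).1 (andP t01).2)); rewrite inE.
Qed.

(** Jensen's inequality for weights that need not sum to one.  Singling out one
    positive weight keeps every partial sum positive, so that the induction
    divides by no zero total. *)
Lemma conic_jensen h (I : Type) (s : seq I) (w0 : R) (w : I -> R) Y0
    (Y : I -> 'M[R]_(n, p)) :
    convex_function [set: 'M[R]_(n, p)] h ->
    0 < w0 -> (forall k, 0 <= w k) ->
  let total := w0 + \sum_(k <- s) w k in
  total * h (total^-1 *: (w0 *: Y0 + \sum_(k <- s) w k *: Y k)) <=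
    w0 * h Y0 + \sum_(k <- s) w k * h (Y k).
Proof.
move=> /convex_functionP hc w0_gt0 w_ge0 /=; elim: s => [|k s IHs].
  by rewrite !big_nil !addr0 scalerA mulVf ?gt_eqF// scale1r.
rewrite !big_cons.
set a := w0 + \sum_(i <- s) w i in IHs.
set S := w0 *: Y0 + \sum_(i <- s) w i *: Y i in IHs.
have a_gt0 : 0 < a by rewrite ltr_wpDr// sumr_ge0.
have b_gt0 : 0 < w k + a by rewrite ltr_wpDl.
rewrite addrCA -/a [_ *: _ + (_ + _)]addrCA -/S.
rewrite [leRHS]addrCA -[leRHS]addrC.
apply: le_trans (lerD IHs (lexx _)).
have t01 : 0 <= a / (w k + a) <= 1.
  by rewrite divr_ge0 ?(ltW a_gt0) ?(ltW b_gt0)//= ler_pdivrMr// mul1r lerDr.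
have := hc _ (a^-1 *: S) (Y k) t01.
have -> : 1 - a / (w k + a) = w k / (w k + a) by field; rewrite gt_eqF.
rewrite scalerA (_ : a / (w k + a) * a^-1 = (w k + a)^-1); last first.
  by field; rewrite !gt_eqF.
rewrite [w k / _]mulrC -scalerA -scalerDr [S + _]addrC => H.
rewrite -ler_pdivlMl//; apply: le_trans H _.
by rewrite le_eqVlt; apply/orP; left; apply/eqP; field; rewrite gt_eqF.
Qed.

(** With [V = W - Y], the point [Y] is the barycenter of [W] with weight 1 and
    of [Y - sg V_ij E_ij] with weights [|V_ij|], because the displacements
    cancel; Jensen's inequality at [Y] then bounds [h W] from below. *)
Lemma convex_cone_minorant h Y :
    convex_function [set: 'M[R]_(n, p)] h ->
  exists2 C, 0 <= C & forall W, h Y - C * mxnorm1 (W - Y) <= h W.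
Proof.
move=> hc.
pose E (k : 'I_n * 'I_p) : 'M[R]_(n, p) := delta_mx k.1 k.2.
(* A bound that serves for both signs of the entry. *)
pose D (k : 'I_n * 'I_p) := `|h (Y + E k) - h Y| + `|h (Y - E k) - h Y|.
have D_ge0 k : 0 <= D k by rewrite addr_ge0.
exists (\sum_k D k) => [|W]; first exact: sumr_ge0.
set C := \sum_k D k; pose V := W - Y.
pose Q k := Y - Num.sg (V k.1 k.2) *: E k.
have := @conic_jensen h _ (index_enum _) 1 (fun k => `|V k.1 k.2|) W Q hc
  ltr01 (fun _ => normr_ge0 _).
rewrite -mxnorm1E /= scale1r mul1r.
have s_ge0 : 0 <= mxnorm1 V by rewrite mxnorm1E sumr_ge0.
have -> : W + \sum_k `|V k.1 k.2| *: Q k = (1 + mxnorm1 V) *: Y.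
  under eq_bigr => k _ do rewrite scalerBr scalerA mulrC -numEsg.
  rewrite sumrB -scaler_suml -mxnorm1E.
  have -> : \sum_k V k.1 k.2 *: E k = V.
    by rewrite [RHS]matrix_sum_delta pair_bigA.
  by rewrite scalerDl scale1r addrCA opprB addrC; congr (_ + _);
    rewrite addrC subrK.
rewrite scalerA mulVf ?scale1r; last by rewrite gt_eqF// ltr_pwDl.
have : \sum_k `|V k.1 k.2| * h (Q k) <= mxnorm1 V * (h Y + C).
  rewrite mxnorm1E mulr_suml; apply: ler_sum => k _.
  have DC : D k <= C by rewrite /C (bigD1 k)//= lerDl sumr_ge0.
  have D1 := ler_norm (h (Y + E k) - h Y).
  have D2 := ler_norm (h (Y - E k) - h Y).
  have D3 := normr_ge0 (h (Y + E k) - h Y).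
  have D4 := normr_ge0 (h (Y - E k) - h Y).
  rewrite /Q; case: sgrP => [_|V_gt0|V_lt0]; first by rewrite !mul0r.
  - by rewrite ler_wpM2l ?(ltW V_gt0)// scale1r; rewrite /D in DC; lra.
  - rewrite ler_wpM2l ?oppr_ge0 ?(ltW V_lt0)// scaleN1r opprK.
    by rewrite /D in DC; lra.
rewrite -/V; nra.
Qed.

(** * Minimizers of strongly convex functions *)

(** Strong convexity of modulus 1, the modulus of half the squared norm. *)
Definition strongly_convex F := forall t Y W, 0 <= t <= 1 ->
  F (t *: Y + (1 - t) *: W) <=
    t * F Y + (1 - t) * F W - t * (1 - t) / 2 * mxinner (Y - W) (Y - W).

Lemma strongly_convex_convex F : strongly_convex F ->
  convex_function [set: 'M[R]_(n, p)] F.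
Proof.
move=> Fsc; apply/convex_functionP => t Y W t01.
apply: le_trans (Fsc t Y W t01) _; rewrite gerBl.
by case/andP: t01 => t0 t1; rewrite !mulr_ge0 ?subr_ge0 ?invr_ge0 ?mxinner_ge0.
Qed.

(** Any two points that nearly minimize [F] are close, as their midpoint would
    otherwise go below the lower bound. *)
Lemma strongly_convex_gap F m Y W : strongly_convex F ->
  (forall V, m <= F V) ->
  mxinner (Y - W) (Y - W) <= 4 * (F Y - m) + 4 * (F W - m).
Proof.
move=> Fsc Fm.
have h01 : 0 <= (2^-1 : R) <= 1 by lra.
by have := Fsc _ Y W h01; have := Fm (2^-1 *: Y + (1 - 2^-1) *: W); lra.
Qed.

(** The minimizer is built entrywise as the common point of the intervals of
    radius [rad Y] around [Y i j], which plays the role of the limit of a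
    minimizing sequence. *)
Lemma strongly_convex_argmin F m : strongly_convex F ->
  (forall Y, m <= F Y) -> exists Y, argmin F Y.
Proof.
move=> Fsc Fm.
pose vals := range F.
have vals_inf : has_inf vals.
  by split; [exists (F 0), 0|exists m => _ [Y _ <-]; exact: Fm].
pose mu := inf vals; pose rad Y := 2 * Num.sqrt (F Y - mu).
have F_ge Y : mu <= F Y by apply: (ge_inf vals_inf.2); exists Y.
have rad_ge0 Y : 0 <= rad Y by rewrite mulr_ge0// sqrtr_ge0.
have rad_sqr Y : rad Y ^+ 2 = 4 * (F Y - mu).
  by rewrite exprMn sqr_sqrtr ?subr_ge0//; ring.
have entry_close Y W i j : `|Y i j - W i j| <= rad Y + rad W.
  rewrite -ler_sqr ?nnegrE ?addr_ge0// real_normK ?num_real//.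
  have := sqr_entry_le (Y - W) i j; rewrite !mxE => /le_trans; apply.
  apply: le_trans (strongly_convex_gap _ _ Fsc F_ge) _.
  by rewrite -!rad_sqr; have := mulr_ge0 (rad_ge0 Y) (rad_ge0 W); nra.
pose lower i j := range (fun Y => Y i j - rad Y).
pose L : 'M[R]_(n, p) := \matrix_(i, j) sup (lower i j).
have lower_ub i j W : ubound (lower i j) (W i j + rad W).
  move=> _ [Y _ <-]; rewrite lerBlDr -addrA -lerBlDl.
  by apply: le_trans (ler_norm _) _; rewrite [leRHS]addrC entry_close.
have L_close Y i j : `|Y i j - L i j| <= rad Y.
  rewrite distrC ler_distl mxE; apply/andP; split.
    by apply: ub_le_sup; [exists (Y i j + rad Y)|exists Y].
  by apply: ge_sup => //; exists (Y i j - rad Y), Y.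
have [C C_ge0 FC] := convex_cone_minorant L (strongly_convex_convex Fsc).
pose N : R := #|{: 'I_n * 'I_p}|%:R.
have FL_le Y : F L <= F Y + C * N * rad Y.
  rewrite -lerBlDr; apply: le_trans (FC Y); rewrite lerB// -mulrA ler_wpM2l//.
  rewrite mxnorm1E mulr_natl -sumr_const; apply: ler_sum => k _.
  by rewrite !mxE; have := L_close Y k.1 k.2; rewrite mxE.
(* It remains to choose [Y] with [rad Y] so small that
   [rad Y ^+ 2 / 4 + C * N * rad Y <= e]; [d <= 1] absorbs the square. *)
exists L => W; apply: le_trans (F_ge W); apply/ler_addgt0Pr => e e_gt0.
have K_gt0 : 0 < 1 + C * N by rewrite ltr_pwDl// mulr_ge0// ler0n.
pose d := Num.min 1 (e / (1 + C * N)).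
have d_gt0 : 0 < d by rewrite lt_min ltr01 divr_gt0.
have d_le1 : d <= 1 by rewrite ge_min lexx.
have d_le : (1 + C * N) * d <= e.
  by rewrite mulrC -ler_pdivlMr// ge_min lexx orbT.
have [_ [Y _ <-] FY] : exists2 v, vals v & v < mu + (d / 2) ^+ 2.
  by apply: inf_adherent => //; rewrite exprn_gt0// divr_gt0.
have rad_lt : rad Y <= d.
  by rewrite -ler_sqr ?nnegrE// ?(ltW d_gt0)// rad_sqr; nra.
apply: le_trans (FL_le Y) _.
have : C * N * rad Y <= C * N * d by rewrite ler_wpM2l// mulr_ge0// ler0n.
have : d * d <= d by rewrite ger_pMl.
nra.
Qed.

(** Moving from [Y] towards [W] by the fraction [t] cannot decrease [F]; strong
    convexity then bounds [F W - F Y] below by [(1 - t) / 2] times the squared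
    distance, and [t] tends to 0. *)
Lemma argmin_quadratic_growth F Y W : strongly_convex F -> argmin F Y ->
  F Y + 2^-1 * mxinner (W - Y) (W - Y) <= F W.
Proof.
move=> Fsc Ymin; set q := mxinner _ _.
have q_ge0 : 0 <= q by exact: mxinner_ge0.
apply/ler_addgt0Pr => e e_gt0.
(* With [q] the squared distance, this choice makes the loss [t / 2 * q] at
   most [e]. *)
pose t := Num.min 1 (e / (1 + q)).
have K_gt0 : 0 < 1 + q by rewrite ltr_pwDl.
have t_gt0 : 0 < t by rewrite lt_min ltr01 divr_gt0.
have t_le1 : t <= 1 by rewrite ge_min lexx.
have t_le : t * (1 + q) <= e by rewrite -ler_pdivlMr// ge_min lexx orbT.
have t01 : 0 <= t <= 1 by rewrite (ltW t_gt0).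
have := Fsc t W Y t01; rewrite -/q => H.
have {}H := le_trans (Ymin _) H.
have : 0 <= t * (F W - F Y - (1 - t) / 2 * q) by lra.
rewrite pmulr_rge0// => {}H.
nra.
Qed.

Lemma argmin_unique F Y : strongly_convex F -> argmin F Y ->
  argmin F = [set Y].
Proof.
move=> Fsc Ymin; apply/seteqP; split => [W Wmin|_ ->//].
apply/eqP; rewrite -subr_eq0 -mxinner_eq0 eq_le mxinner_ge0 andbT.
by have := argmin_quadratic_growth W Fsc Ymin; have := Wmin Y; lra.
Qed.

(** * The proximal operator *)

Lemma prox_objective_strongly_convex h Z :
  convex_function [set: 'M[R]_(n, p)] h -> strongly_convex (prox_objective h Z).
Proof.
move=> /convex_functionP hc t Y W t01.
rewrite /prox_objective !sqr_frobenius_norm mxinner_convex.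
by have := hc t Y W t01; lra.
Qed.

(** The cone below [h] at [Z] loses [C |v|] in each entry [v] of [Y - Z], and
    [C |v| <= v ^+ 2 / 2 + C ^+ 2 / 2]. *)
Lemma prox_objective_bounded h Z :
  convex_function [set: 'M[R]_(n, p)] h ->
  exists m, forall Y, m <= prox_objective h Z Y.
Proof.
move=> /(convex_cone_minorant Z)[C C_ge0 hC].
exists (h Z - \sum_(k : 'I_n * 'I_p) 2^-1 * C ^+ 2) => Y.
rewrite /prox_objective sqr_frobenius_norm -lerBlDr.
apply: le_trans (hC Y); rewrite -addrA lerD2l lerNr opprD !opprK.
rewrite mxnorm1E mxinnerE !mulr_sumr -big_split /=; apply: ler_sum => k _.
rewrite -expr2 -(real_normK (num_real ((Y - Z) k.1 k.2))).
by have := sqr_ge0 (C - `|(Y - Z) k.1 k.2|); nra.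
Qed.

Lemma argmin_prox_objective h Z : convex_function [set: 'M[R]_(n, p)] h ->
  argmin (prox_objective h Z) = [set prox h Z].
Proof.
move=> hc; have hsc := prox_objective_strongly_convex Z hc.
have [m hm] := prox_objective_bounded Z hc.
apply: argmin_unique => //.
by apply: xgetPex; exact: strongly_convex_argmin hsc hm.
Qed.

(** The subgradient inequality for [Z - Y] and the quadratic growth of the
    proximal objective around [Y] are the same inequality, by the law of
    cosines. *)
Lemma argmin_prox_subdifferential h Z Y :
  convex_function [set: 'M[R]_(n, p)] h ->
  argmin (prox_objective h Z) Y <-> subdifferential h Y (Z - Y).
Proof.
move=> hc; split=> [Ymin W|Ysub W].
- have := argmin_quadratic_growth W (prox_objective_strongly_convex Z hc) Ymin.
  by rewrite /prox_objective !sqr_frobenius_norm (mxinner_cosine Y W Z); lra.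
- have := Ysub W.
  rewrite /prox_objective !sqr_frobenius_norm (mxinner_cosine Y W Z).
  by have := mxinner_ge0 (W - Y); lra.
Qed.

Lemma prox_subdifferential h Z Y :
  convex_function [set: 'M[R]_(n, p)] h ->
  prox h Z = Y <-> subdifferential h Y (Z - Y).
Proof.
by move=> hc; rewrite -argmin_prox_subdifferential// argmin_prox_objective.
Qed.

(** * Soft-thresholding *)

(** That [z - s] is a subgradient of [c * `|x|] at the thresholded value [s]:
    when [s = 0] the residual is [z], of size at most [c]; otherwise it is [c]
    with the sign of [s]. *)
Lemma soft_threshold_subgradient c z w : 0 <= c ->
  let s := Num.sg z * Num.max (`|z| - c) 0 in
  c * `|s| + (z - s) * (w - s) <= c * `|w|.
Proof.
move=> c_ge0 /=.
have w1 := ler_norm w; have w2 := ler_norm (- w); rewrite normrN in w2.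
have [zc|zc] := leP (`|z| - c) 0.
  rewrite mulr0 normr0 !subr0 mulr0 add0r; apply: le_trans (ler_norm _) _.
  by rewrite normrM ler_wpM2r//; lra.
have z_neq0 : z != 0 by apply: contraTneq zc => ->; rewrite normr0 -leNgt; lra.
rewrite normrM normr_sg z_neq0 mul1r gtr0_norm//.
move: zc z_neq0; case: sgrP => // z_cmp zc _.
- have : c * w <= c * `|w| by rewrite ler_wpM2l.
  by nra.
- have : c * (- w) <= c * `|w| by rewrite ler_wpM2l.
  by nra.
Qed.

Lemma convex_mxnorm1 c : 0 <= c ->
  convex_function [set: 'M[R]_(n, p)] (fun Y => c * mxnorm1 Y).
Proof.
move=> c_ge0; apply/convex_functionP => t Y W /andP[t_ge0 t_le1].
rewrite mulrCA [X in _ <= _ + X]mulrCA -mulrDr ler_wpM2l// !mxnorm1E.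
rewrite !mulr_sumr -big_split /=; apply: ler_sum => k _.
rewrite !mxE (le_trans (ler_normD _ _))// !normrM (ger0_norm t_ge0).
by rewrite [`|1 - t|]ger0_norm// subr_ge0.
Qed.

Lemma prox_mxnorm1 c Z i j : 0 <= c ->
  prox (fun Y => c * mxnorm1 Y) Z i j
    = Num.sg (Z i j) * Num.max (`|Z i j| - c) 0.
Proof.
move=> c_ge0.
pose S : 'M[R]_(n, p) :=
  \matrix_(i, j) (Num.sg (Z i j) * Num.max (`|Z i j| - c) 0).
suff -> : prox (fun Y => c * mxnorm1 Y) Z = S by rewrite mxE.
apply/prox_subdifferential => [|W]; first exact: convex_mxnorm1.
rewrite !mxnorm1E mxinnerE !mulr_sumr -big_split /=; apply: ler_sum => k _.
by rewrite !mxE; exact: soft_threshold_subgradient.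
Qed.

(** * The augmented Lagrangian subproblem *)

Lemma subdifferential_scale h c Y G : 0 < c ->
  subdifferential (fun V => h V / c) Y G -> subdifferential h Y (c *: G).
Proof.
move=> c_gt0 hG W; have := hG W.
have -> : mxinner (c *: G) (W - Y) = c * mxinner G (W - Y).
  by rewrite !mxinnerE mulr_sumr; apply: eq_bigr => k _; rewrite mxE mulrA.
by rewrite -(ler_pM2l c_gt0) mulrDr ![c * (_ / c)]mulrC !divfK ?gt_eqF.
Qed.

(** Completing the square in [Y]: [G] moves into the center of the quadratic
    term and leaves a constant behind. *)
Lemma augmented_lagrangianE h c X G Y : c != 0 ->
  h Y + mxinner G (X - Y) + c / 2 * frobenius_norm (X - Y) ^+ 2 =
  c * prox_objective (fun V => h V / c) (X + c^-1 *: G) Y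
    - (2 * c)^-1 * mxinner G G.
Proof.
move=> c_neq0; rewrite /prox_objective !sqr_frobenius_norm.
rewrite mulrDr [c * (_ / c)]mulrC divfK// -!addrA; congr (_ + _).
rewrite !mxinnerE !mulr_sumr -big_split -sumrB /=.
by apply: eq_bigr => k _; rewrite !mxE; field.
Qed.

Lemma argmin_affine F a b : 0 < a ->
  argmin (fun Y => a * F Y + b) = argmin F.
Proof.
move=> a_gt0; apply/seteqP; split => Y Ymin W; have := Ymin W;
  by rewrite lerD2r ler_pM2l.
Qed.

End Convexity.

Theorem lemma1 (R : realType) (n p : nat) (r : 'M[R]_(n, p) -> R)
    (r_convex : convex_function [set: 'M[R]_(n, p)] r)
    (beta : R) (beta_gt0 : 0 < beta)
    (X Lambda : 'M[R]_(n, p)) (X_stiefel : stiefel n p X) :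
  let r_beta := fun Y : 'M[R]_(n, p) => r Y / beta in
  let Y1 := prox r_beta (X + beta^-1 *: Lambda) in
  let Lambda1 := Lambda + beta *: (X - Y1) in
  [/\ (* the proximal operator is well defined *)
      forall Z : 'M[R]_(n, p),
        argmin (prox_objective r_beta Z) = [set prox r_beta Z],
      argmin (fun Y : 'M[R]_(n, p) =>
        r Y + mxinner Lambda (X - Y)
          + beta / 2 * frobenius_norm (X - Y) ^+ 2) = [set Y1],
      subdifferential r Y1 Lambda1
    & forall mu : R, 0 < mu ->
      (forall Y : 'M[R]_(n, p), r Y = mu * mxnorm1 Y) ->
      forall (Z : 'M[R]_(n, p)) (i : 'I_n) (j : 'I_p),
        prox r_beta Z i j
          = Num.sg (Z i j) * Num.max (`|Z i j| - mu / beta) 0].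
Proof.
move=> r_beta Y1 Lambda1.
have beta_neq0 : beta != 0 by rewrite gt_eqF.
have rb_convex : convex_function [set: 'M[R]_(n, p)] r_beta.
  apply/convex_functionP => t Y W t01; rewrite /r_beta ler_pdivrMr// mulrDl.
  by rewrite -!mulrA mulVf// !mulr1; apply: (proj1 (convex_functionP r)).
have rb_argmin Z := argmin_prox_objective Z rb_convex.
split=> [//||| mu mu_gt0 r_mu Z i j].
- pose b := - ((2 * beta)^-1 * mxinner Lambda Lambda).
  rewrite -rb_argmin -[RHS](argmin_affine _ b beta_gt0).
  by apply: congr1; apply/funext => Y; rewrite augmented_lagrangianE.
- have Lambda1E : beta *: (X + beta^-1 *: Lambda - Y1) = Lambda1.
    by rewrite [X + _]addrC -addrA scalerDr scalerA mulfV// scale1r.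
  rewrite -Lambda1E.
  by apply: subdifferential_scale => //; apply/prox_subdifferential.
- have rbE : r_beta = (fun Y => mu / beta * mxnorm1 Y).
    by apply/funext => Y; rewrite /r_beta r_mu mulrAC.
  by rewrite rbE prox_mxnorm1// divr_ge0 ?ltW.
Qed.
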